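(* Let $(G_n)_{n\ge 2}$ be a sequence of random graphs following the linear de-preferential attachment model with $m=1$. Let $$P_k(n):=\frac1n\sum_{i=1}^n \mathbf{1}\left(d_i(n)=k\right)$$ be the fraction of vertices of $G_n$ with degree $k$, and let $p_k=\frac{1}{2^k}$ for $k\ge 1$. Then there exists a constant $C_1>0$ such that, as $n\to\infty$, $$P\left(\max_{k\ge 1}\left|P_k(n)-p_k\right|>C_1\left(\frac{\log n}{n}+\sqrt{\frac{\log n}{n}}\right)\right)=o(1).$$
   Context: Linear de-preferential attachment model with $m=1$: the graph $G_n$ has vertices $v_1,\dots,v_n$, and $d_i(n)$ denotes the degree of $v_i$ in $G_n$ (all incident edges and half-edges counted). The process starts from $G_2$, consisting of two vertices $v_1,v_2$ joined by an edge together with one extra ''free'' edge (half-edge) attached to one of the two vertices, which counts toward that vertex's degree; thus the degrees in $G_2$ are $1$ and $2$, and the degrees in $G_n$ sum to $2n-1$. Given $G_n$, a new vertex $v_{n+1}$ is added with a single edge $e_{n+1}$ joining it to one of $v_1,\dots,v_n$. With $\mathscr{F}_n$ the natural filtration of the process, $$P(e_{n+1}=\{v_{n+1},v_i\}\mid \mathscr{F}_n)=\frac{1}{n-1}\left(1-\frac{d_i(n)}{2n-1}\right),\qquad i=1,\dots,n.$$ Thus the chosen vertex's degree increases by one and $d_{n+1}(n+1)=1$. *)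

(* Defs.v *)
From HB Require Import structures.
From mathcomp Require Import all_boot all_order all_algebra.
From mathcomp Require Import all_classical all_reals all_analysis.
Set Implicit Arguments.
Unset Strict Implicit.
Unset Printing Implicit Defensive.
Import Order.TTheory GRing.Theory Num.Theory.
Import numFieldNormedType.Exports.
Local Open Scope classical_set_scope.
Local Open Scope ring_scope.

(* Vertices are 1, ..., nverts.  The edge between a and b < a is stored as the
   pair (a, b); half_edges lists the endpoint of each half-edge. *)
Record hgraph := HGraph {
  nverts : nat ;
  edges : seq (nat * nat) ;
  half_edges : seq nat }.

Definition degree (g : hgraph) (i : nat) : nat :=
  (count (fun e => (e.1 == i) || (e.2 == i)) (edges g)
   + count_mem i (half_edges g))%N.

(* The two-vertex tree with a free half-edge at vertex h. *)
Definition initial_graph (h : nat) : hgraph :=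
  HGraph 2 [:: (2, 1)%N] [:: h].

Definition attach (g : hgraph) (i : nat) : hgraph :=
  HGraph (nverts g).+1 (((nverts g).+1, i) :: edges g) (half_edges g).

Section Process.
Context {R : realType} {d : measure_display} {T : measurableType d}.

(* sigma(G_2, ..., G_n), with every set of graphs regarded as measurable
   (there are only countably many graphs). *)
Definition natural_filtration (G : nat -> T -> hgraph) (n : nat)
    : set (set T) :=
  <<s [set A | exists m, exists B : set hgraph,
         (2 <= m <= n)%N /\ A = G m @^-1` B] >>.

(* f is a version of the conditional probability P(E | F). *)
Definition is_cond_prob (P : probability T R) (F : set (set T)) (E : set T)
    (f : T -> R) : Prop :=
  (forall Y : set R, measurable Y -> F (f @^-1` Y)) /\
  (forall A : set T, F A -> P (E `&` A) = (\int[P]_(t in A) (f t)%:E)%E).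

Definition attach_prob (g : hgraph) (n i : nat) : R :=
  (n%:R - 1)^-1 * (1 - (degree g i)%:R / (2 * n%:R - 1)).

(* Nothing is required of G 0 and G 1. *)
Record depreferential_attachment (P : probability T R)
    (G : nat -> T -> hgraph) : Prop := DepreferentialAttachment {
  depref_measurable : forall n (B : set hgraph), (2 <= n)%N ->
    measurable (G n @^-1` B) ;
  depref_init : forall t, G 2 t = initial_graph 1 \/ G 2 t = initial_graph 2 ;
  depref_step : forall n t, (2 <= n)%N ->
    exists i, (1 <= i <= n)%N /\ G n.+1 t = attach (G n t) i ;
  depref_law : forall n i, (2 <= n)%N -> (1 <= i <= n)%N ->
    is_cond_prob P (natural_filtration G n)
      [set t | G n.+1 t = attach (G n t) i]
      (fun t => attach_prob (G n t) n i) }.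

End Process.

Definition degree_fraction {R : realType} (g : hgraph) (n k : nat) : R :=
  n%:R^-1 * \sum_(1 <= i < n.+1) (degree g i == k)%:R.

Definition limit_fraction {R : realType} (k : nat) : R := (2 ^+ k)^-1.

(* The supremum is a maximum: both fractions tend to 0 as k grows. *)
Definition max_deviation {R : realType} (g : hgraph) (n : nat) : R :=
  sup [set `|degree_fraction g n k - limit_fraction k| | k in [set k | (1 <= k)%N]].

(* Main.v *)
(* Second-moment proof.  Let N_k(n) be the number of vertices of degree k and
   x_k = N_k(n) - n p_k.  Given G_n, the mean increment of x_k is
   (x_(k-1) - x_k) / n up to an error of l^1 norm O(1/n), because attachment is
   nearly uniform and 2 p_k = p_(k-1).  The main term is dissipative for the
   energy sum_k x_k^2 (Cauchy-Schwarz and telescoping), the error contributes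
   O(1) because |x_k| <= n, and the squared jump is O(1); so the mean energy
   grows by O(1) per step and is O(n).  By Markov's inequality it is at most
   n ln n with probability 1 - O(1 / ln n), which bounds every |x_k| at once.
   Only k <= n enters the energy; for larger k both N_k(n) and n p_k are O(1),
   as the degrees sum to 2n - 1. *)
Require Import Defs.
From HB Require Import structures.
From mathcomp Require Import all_boot all_order all_algebra.
From mathcomp Require Import all_classical all_reals all_analysis.
From mathcomp Require Import zify ring lra.
Set Implicit Arguments.
Unset Strict Implicit.
Unset Printing Implicit Defensive.
Import Order.TTheory GRing.Theory Num.Theory.
Import numFieldNormedType.Exports.
Local Open Scope classical_set_scope.
Local Open Scope ring_scope.

(** * Invariants of the graphs and their preservation under attachment *)

HB.instance Definition _ := gen_eqMixin hgraph.

(** The last clause is total degree 2n - 1, written without truncated subtraction. The second makes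
    a new vertex start from degree 0; the third excludes degree 0 among existing vertices. *)
Definition well_formed (n : nat) (g : hgraph) : Prop :=
  [/\ nverts g = n, forall i, (n < i)%N -> degree g i = 0%N,
      forall i, (1 <= i <= n)%N -> (0 < degree g i)%N
    & (\sum_(1 <= i < n.+1) degree g i).+1 = n.*2 ].

Lemma degree_attach g i j :
  degree (attach g i) j = (((nverts g).+1 == j) || (i == j) + degree g j)%N.
Proof. by rewrite /degree /= addnA. Qed.

Lemma attach_inj g i g' i' : attach g i = attach g' i' -> g = g' /\ i = i'.
Proof. by case: g g' => [n e h] [n' e' h'] [*]; subst. Qed.

Lemma well_formed_init h : (1 <= h <= 2)%N -> well_formed 2 (initial_graph h).
Proof.
move=> hh; have /orP [/eqP->|/eqP->] : (h == 1)%N || (h == 2)%N by lia.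
- by split=> [//|[|[|[|i]]]|[|[|[|i]]]|] //; rewrite unlock.
- by split=> [//|[|[|[|i]]]|[|[|[|i]]]|] //; rewrite unlock.
Qed.

Lemma well_formed_attach n g i : (1 <= i <= n)%N ->
  well_formed n g -> well_formed n.+1 (attach g i).
Proof.
move=> hi [gn g0 gpos gsum]; split.
- by rewrite /= gn.
- by move=> j hj; rewrite degree_attach gn g0; lia.
- move=> j hj; rewrite degree_attach gn.
  case: (ltngtP j n.+1) hj => hj hj'; try lia.
  by have := gpos j; lia.
- rewrite big_nat_recr //= degree_attach gn eqxx g0 // addn0 /=.
  rewrite (eq_big_nat _ _ (F2 := fun j => ((if j == i then 1 else 0) + degree g j)%N)); last first.
    by move=> j hj; rewrite degree_attach gn eq_sym (eq_sym i); case: (eqVneq j i) => _; lia.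
  rewrite big_split /= -big_mkcond /= big_nat1_eq ltnS hi; lia.
Qed.

(** * Degree counts, the limit law and the energy *)

Section Counts.
Variable R : realType.
Implicit Types (g : hgraph) (n i j k K : nat).

Definition degree_count g n k : R := \sum_(1 <= i < n.+1) (degree g i == k)%:R.

Lemma degree_count_attach n g i k : (1 <= i <= n)%N -> well_formed n g ->
  degree_count (attach g i) n.+1 k =
  degree_count g n k + (k == 1%N)%:R
   + ((degree g i).+1 == k)%:R - (degree g i == k)%:R.
Proof.
move=> hi [gn g0 _ _]; rewrite /degree_count big_nat_recr //= degree_attach gn eqxx g0 //=.
rewrite (eq_big_nat _ _ (F2 := fun j => (if j == i then
  ((degree g i).+1 == k)%:R - (degree g i == k)%:R else 0) + (degree g j == k)%:R : R)); last first.
  move=> j hj; rewrite degree_attach gn.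
  case: (eqVneq j i) => [->|ji]; first by rewrite orbT add1n subrK.
  have -> : (n.+1 == j) = false by lia.
  by rewrite add0n add0r.
rewrite big_split /= -big_mkcond /= big_nat1_eq ltnS hi addn0 (eq_sym k); ring.
Qed.

(* The limit law with its value at degree 0 set to 0 instead of 1. *)
Definition limit_mass k : R := if k is 0%N then 0 else limit_fraction k.

(** Balance equation of uniform attachment; the indicator is the newborn vertex of degree 1. *)
Lemma limit_massS k : 2 * limit_mass k.+1 = limit_mass k + (k.+1 == 1%N)%:R.
Proof.
rewrite /limit_mass /limit_fraction; case: k => [|k] /=.
  by rewrite expr1 mulfV // add0r.
by rewrite addr0 exprS invfM mulrA mulfV // mul1r.
Qed.

Lemma limit_mass_ge0 k : 0 <= limit_mass k.
Proof. by case: k => [|k] //=; rewrite invr_ge0 exprn_ge0. Qed.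

Lemma sum_limit_mass K : \sum_(k < K) limit_mass k.+1 = 1 - (2 ^+ K)^-1.
Proof.
elim: K => [|K IH]; first by rewrite big_ord0 expr0 invr1 subrr.
rewrite big_ord_recr /= IH /limit_fraction exprS invfM; lra.
Qed.

Lemma sum_limit_mass_le1 K : \sum_(k < K) limit_mass k.+1 <= 1.
Proof. by rewrite sum_limit_mass gerBl invr_ge0 exprn_ge0. Qed.

Lemma limit_mass_le1 k : limit_mass k <= 1.
Proof.
case: k => [|k] /=; first exact: ler01.
by rewrite /limit_fraction invf_le1 ?exprn_gt0 // exprn_ege1 // ler1n.
Qed.

Lemma mul_limit_mass_le1 k : k%:R * limit_mass k <= 1.
Proof.
case: k => [|k]; first by rewrite mul0r ler01.
by rewrite ler_pdivrMr ?exprn_gt0 // mul1r -natrX ler_nat ltnW // ltn_expl.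
Qed.

Arguments limit_mass : simpl never.

Definition excess g n k : R := degree_count g n k - n%:R * limit_mass k.

Definition energy K n g : R := \sum_(k < K) (excess g n k.+1) ^+ 2.

Lemma degree_count_ge0 g n k : 0 <= degree_count g n k.
Proof. by apply: sumr_ge0 => i _; rewrite ler0n. Qed.

Lemma degree_count_le g n k : degree_count g n k <= n%:R.
Proof.
apply: (@le_trans _ _ (\sum_(1 <= i < n.+1) 1)).
  by apply: ler_sum => i _; rewrite lern1 leq_b1.
by rewrite sumr_const_nat subSS subn0.
Qed.

Lemma normr_excess_le g n k : `|excess g n k| <= n%:R.
Proof.
have := degree_count_ge0 g n k; have := degree_count_le g n k.
have := limit_mass_ge0 k; have := limit_mass_le1 k; have : (0:R) <= n%:R by [].
by rewrite /excess => *; rewrite ler_norml; apply/andP; split; nra.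
Qed.

Lemma sum_pick_le1 K a : \sum_(k < K) (a == k.+1)%:R <= 1 :> R.
Proof.
apply: (@le_trans _ _ (\sum_(k < K | a == k.+1) 1)).
  by rewrite [leRHS]big_mkcond; apply: ler_sum => k _; case: eqP.
case: (pickP (fun k : 'I_K => a == k.+1)) => [k /eqP ak|no].
  rewrite (big_pred1 k) // => j; rewrite ak eqSS; exact/eq_sym.
by rewrite big_pred0.
Qed.

Lemma normr_sum_pick_le K a n (x : nat -> R) : (forall k, `|x k| <= n%:R) ->
  `|\sum_(k < K) x k.+1 * (a == k.+1)%:R| <= n%:R.
Proof.
move=> hx; apply: (le_trans (ler_norm_sum _ _ _)).
apply: (@le_trans _ _ (\sum_(k < K) n%:R * (a == k.+1)%:R)).
  by apply: ler_sum => k _; rewrite normrM normr_nat ler_wpM2r.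
by rewrite -mulr_sumr ler_piMr // sum_pick_le1.
Qed.

(** * One-step drift of the energy *)

Lemma sumr_degree n g : well_formed n g ->
  \sum_(1 <= i < n.+1) (degree g i)%:R = 2 * n%:R - 1 :> R.
Proof.
move=> [_ _ _ gsum]; have /(congr1 (fun m => m%:R : R)) := gsum.
rewrite -natr1 -muln2 natrM natr_sum => h.
by rewrite -[LHS](addrK 1) h mulrC.
Qed.

Lemma sum_attach_prob n g : (2 <= n)%N -> well_formed n g ->
  \sum_(1 <= i < n.+1) attach_prob g n i = 1 :> R.
Proof.
move=> n2 gw; rewrite /attach_prob -mulr_sumr big_split /= sumrN -mulr_suml.
rewrite sumr_degree // sumr_const_nat subSS subn0.
have : (2:R) <= n%:R by rewrite ler_nat.
move=> hn; field; apply/andP; split; lra.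
Qed.

(** Each difference is (1/n - d_i/(2n-1)) / (n-1). Both fractions sum to 1 over i, so the l^1
    distance to the uniform law is at most 2/(n-1), hence at most 4/n. *)
Lemma sum_attach_prob_dist n g : (2 <= n)%N -> well_formed n g ->
  n%:R * \sum_(1 <= i < n.+1) `|attach_prob g n i - n%:R^-1| <= 4 :> R.
Proof.
move=> n2 gw; have hn : (2:R) <= n%:R by rewrite ler_nat.
have n1 : 0 < n%:R - 1 :> R by lra.
apply: (@le_trans _ _ (n%:R * \sum_(1 <= i < n.+1)
    ((n%:R - 1)^-1 * (n%:R^-1 + (degree g i)%:R / (2 * n%:R - 1))))).
  apply: ler_wpM2l => //; apply: ler_sum => i _.
  have -> : attach_prob g n i - n%:R^-1 =
     (n%:R - 1)^-1 * (n%:R^-1 - (degree g i)%:R / (2 * n%:R - 1)) :> R.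
    rewrite /attach_prob; field; rewrite -?natr1; apply/and3P; split; lra.
  rewrite normrM gtr0_norm ?invr_gt0 // ler_pM2l ?invr_gt0 //.
  apply: (le_trans (ler_normB _ _)); rewrite !ger0_norm ?divr_ge0 ?invr_ge0 //; lra.
rewrite -mulr_sumr big_split /= -mulr_suml sumr_degree // sumr_const_nat subSS subn0.
rewrite -[n%:R^-1 *+ n]mulr_natr mulVf; last by lra.
rewrite divff; last by lra.
by rewrite mulrCA mulrC ler_pdivrMr //; lra.
Qed.

(** Since ab <= (a^2 + b^2)/2, each term is at most half the difference of consecutive squares, and
    these telescope. *)
Lemma sum_excess_drift K (x : nat -> R) : x 0%N = 0 ->
  \sum_(k < K) x k.+1 * (x k - x k.+1) <= 0.
Proof.
move=> x0; apply: (@le_trans _ _ (\sum_(0 <= k < K) (- (x k.+1 ^+ 2 / 2) - - (x k ^+ 2 / 2)))).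
  rewrite big_mkord; apply: ler_sum => k _.
  have := sqr_ge0 (x k - x k.+1); rewrite !expr2; nra.
rewrite telescope_sumr // x0; have := sqr_ge0 (x K); rewrite !expr2; nra.
Qed.

Lemma attach_prob_ge0 n g i : (2 <= n)%N -> (1 <= i <= n)%N ->
  well_formed n g -> 0 <= attach_prob g n i :> R.
Proof.
move=> n2 hi gw; have hn : (2:R) <= n%:R by rewrite ler_nat.
rewrite /attach_prob mulr_ge0 ?invr_ge0 ?subr_ge0 //; first lra.
rewrite ler_pdivrMr; last lra.
rewrite mul1r -(sumr_degree gw) (big_rem i) /=; last by rewrite mem_index_iota ltnS.
by rewrite lerDl sumr_ge0.
Qed.

Lemma excess0 n g : well_formed n g -> excess g n 0 = 0.
Proof.
move=> [_ _ gpos _]; rewrite /excess mulr0 subr0 /degree_count big_nat_cond big1 // => i.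
rewrite andbT ltnS => /gpos; by case: (degree g i).
Qed.

(** Contribution to N_k of the chosen vertex, whose degree passes from [a] to [a.+1]. *)
Definition jump a k : R := (a.+1 == k)%:R - (a == k)%:R.

Lemma excess_attach n g i k : (1 <= i <= n)%N -> well_formed n g ->
  excess (attach g i) n.+1 k =
  excess g n k + ((k == 1%N)%:R - limit_mass k + jump (degree g i) k).
Proof.
by move=> hi gw; rewrite /excess degree_count_attach // -natr1 /jump; ring.
Qed.

Lemma normr_sum_jump_le K a n (x : nat -> R) : (forall k, `|x k| <= n%:R) ->
  `|\sum_(k < K) x k.+1 * jump a k.+1| <= 2 * n%:R.
Proof.
move=> hx; under eq_bigr do rewrite /jump mulrBr.
rewrite big_split /= sumrN.
apply: (le_trans (ler_normB _ _)); rewrite mulr_natl mulr2n.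
by apply: lerD; exact: normr_sum_pick_le.
Qed.

(** The increment u has four parts, each of size at most 1 and of l^1 norm at most 1; thus u^2 <= 4
    |u|, which sums to at most 16. *)
Lemma sum_sqr_increment_le K a :
  \sum_(k < K) ((k.+1 == 1%N)%:R - limit_mass k.+1 + jump a k.+1) ^+ 2 <= 16.
Proof.
have h1 := sum_pick_le1 K 1%N; have h2 := sum_limit_mass_le1 K.
have h3 := sum_pick_le1 K a.+1; have h4 := sum_pick_le1 K a.
apply: (@le_trans _ _ (\sum_(k < K) 4 * ((1%N == k.+1)%:R + limit_mass k.+1
   + (a.+1 == k.+1)%:R + (a == k.+1)%:R))).
  apply: ler_sum => k _; rewrite /jump (eq_sym k.+1).
  have := limit_mass_le1 k.+1; have := limit_mass_ge0 k.+1.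
  move: (limit_mass _) => p p0 p1.
  by do 3!(case: (_ == _)) => /=; rewrite expr2; nra.
rewrite -mulr_sumr !big_split /=; lra.
Qed.

Lemma energy_drift K n g : (2 <= n)%N -> well_formed n g ->
  \sum_(1 <= i < n.+1) attach_prob g n i * energy K n.+1 (attach g i)
  <= energy K n g + 32.
Proof.
move=> n2 gw; have hn : (2:R) <= n%:R by rewrite ler_nat.
have nn0 : n%:R != 0 :> R by lra.
pose x k := excess g n k.
(* The cross term of the expanded square splits into [B], independent of the chosen vertex, and
   [L i]. *)
pose B := \sum_(k < K) x k.+1 * ((k.+1 == 1%N)%:R - limit_mass k.+1).
pose L i := \sum_(k < K) x k.+1 * jump (degree g i) k.+1.
have step i : (1 <= i <= n)%N ->
    energy K n.+1 (attach g i) <= energy K n g + 2 * B + 16 + 2 * L i.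
  move=> hi; have := sum_sqr_increment_le K (degree g i).
  suff -> : energy K n.+1 (attach g i) = energy K n g + 2 * B + 2 * L i +
    \sum_(k < K) ((k.+1 == 1%N)%:R - limit_mass k.+1 + jump (degree g i) k.+1) ^+ 2 by lra.
  rewrite /energy /B /L !mulr_sumr -!big_split /=; apply: eq_bigr => k _.
  by rewrite excess_attach // -/(x k.+1); ring.
(* Passing to the uniform law costs 8: |L i| <= 2n against an l^1 distance of at most 4/n. *)
have mean_L : \sum_(1 <= i < n.+1) attach_prob g n i * L i <=
    n%:R^-1 * (\sum_(1 <= i < n.+1) L i) + 8.
  have -> : \sum_(1 <= i < n.+1) attach_prob g n i * L i =
     n%:R^-1 * (\sum_(1 <= i < n.+1) L i) +
     \sum_(1 <= i < n.+1) (attach_prob g n i - n%:R^-1) * L i.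
    by rewrite mulr_sumr -big_split /=; apply: eq_bigr => i _; ring.
  rewrite lerD2l; apply: (@le_trans _ _
    (\sum_(1 <= i < n.+1) `|attach_prob g n i - n%:R^-1| * (2 * n%:R))).
    apply: ler_sum => i _; apply: (le_trans (ler_norm _)); rewrite normrM.
    by rewrite ler_wpM2l // normr_sum_jump_le // => k; exact: normr_excess_le.
  by rewrite -mulr_suml; have := sum_attach_prob_dist n2 gw; lra.
(* A uniformly chosen vertex has mean jump (N_k - N_(k+1)) / n at degree k+1. *)
have sum_L : n%:R^-1 * (\sum_(1 <= i < n.+1) L i) =
    \sum_(k < K) x k.+1 * (n%:R^-1 * (x k - x k.+1) + limit_mass k - limit_mass k.+1).
  rewrite /L exchange_big /= mulr_sumr; apply: eq_bigr => k _.
  rewrite -mulr_sumr /jump big_split /= sumrN.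
  under eq_bigr do rewrite eqSS.
  rewrite -/(degree_count g n k) -/(degree_count g n k.+1) /x /excess.
  by field.
(* The balance equation cancels every term free of differences of x, leaving the dissipative sum. *)
have drift : B + n%:R^-1 * (\sum_(1 <= i < n.+1) L i) <= 0.
  rewrite sum_L /B -big_split /=.
  rewrite (eq_bigr (fun k : 'I_K => n%:R^-1 * (x k.+1 * (x k - x k.+1)))); last first.
    move=> k _; have -> : limit_mass k = 2 * limit_mass k.+1 - (k.+1 == 1%N)%:R.
      by rewrite limit_massS addrK.
    by ring.
  by rewrite -mulr_sumr pmulr_rle0 ?invr_gt0 ?sum_excess_drift ?[x 0%N]excess0 //; lra.
(* The total is 32 = 16 + 2 * 8: squared increment plus twice the non-uniformity error. *)
apply: (@le_trans _ _ (\sum_(1 <= i < n.+1)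
   (attach_prob g n i * (energy K n g + 2 * B + 16) + 2 * (attach_prob g n i * L i)))).
  apply: ler_sum_nat => i; rewrite ltnS => hi.
  have := step i hi; have := attach_prob_ge0 n2 hi gw; nra.
rewrite big_split /= -mulr_suml sum_attach_prob // -mulr_sumr; lra.
Qed.

(** * Deterministic bounds on the energy and the counts *)

Lemma sum_degree_count_le K g n : \sum_(k < K) degree_count g n k.+1 <= n%:R.
Proof.
rewrite /degree_count exchange_big /=.
apply: (@le_trans _ _ (\sum_(1 <= i < n.+1) 1)).
  by apply: ler_sum => i _; exact: sum_pick_le1.
by rewrite sumr_const_nat subSS subn0.
Qed.

(** One factor |x_k| is at most n and the other sums to at most 2n. At n = 2 this starts the
    induction on the mean energy, uniformly in [K]. *)
Lemma energy_le K n g : energy K n g <= 2 * n%:R ^+ 2.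
Proof.
apply: (@le_trans _ _ (\sum_(k < K) n%:R * (degree_count g n k.+1 + n%:R * limit_mass k.+1))).
  apply: ler_sum => k _; rewrite -real_normK ?num_real // expr2.
  apply: ler_pM => //; first exact: normr_excess_le.
  apply: (le_trans (ler_normB _ _)).
  by rewrite !ger0_norm ?mulr_ge0 ?degree_count_ge0 ?limit_mass_ge0.
rewrite -mulr_sumr big_split /= -mulr_sumr.
have := sum_degree_count_le K g n; have := sum_limit_mass_le1 K.
have : 0 <= n%:R :> R by []; nra.
Qed.

Lemma energy_ge0 K n g : 0 <= energy K n g.
Proof. by apply: sumr_ge0 => k _; exact: sqr_ge0. Qed.

Lemma mul_degree_count_le n g k : well_formed n g ->
  k%:R * degree_count g n k <= 2 * n%:R - 1.
Proof.
move=> gw; rewrite -(sumr_degree gw) mulr_sumr; apply: ler_sum => i _.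
by case: eqP => [->|_]; rewrite ?mulr1 ?mulr0.
Qed.

End Counts.

(** * Reachable graphs, and expectations as finite sums over them *)

Fixpoint reachable n : seq hgraph :=
  if n is m.+1 then
    if (2 <= m)%N then [seq attach g i | g <- reachable m, i <- index_iota 1 m.+1]
    else [:: initial_graph 1; initial_graph 2]
  else [::].

Lemma reachableS n : (2 <= n)%N ->
  reachable n.+1 = [seq attach g i | g <- reachable n, i <- index_iota 1 n.+1].
Proof. by rewrite /=; case: ifP. Qed.

Lemma reachable_well_formed n g : (2 <= n)%N -> g \in reachable n -> well_formed n g.
Proof.
elim: n g => [//|n IH] g; rewrite leq_eqVlt => /predU1P [<-|n2].
  by rewrite !inE => /orP [/eqP->|/eqP->]; exact: well_formed_init.
rewrite reachableS // => /allpairsP [[h i] /= [hr]].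
by rewrite mem_index_iota ltnS => hi ->; apply: well_formed_attach => //; exact: IH.
Qed.

Section Expectation.
Variables (R : realType) (d : measure_display) (T : measurableType d).
Variables (P : probability T R) (G : nat -> T -> hgraph).
Hypothesis HG : depreferential_attachment P G.

Lemma process_reachable n t : (2 <= n)%N -> G n t \in reachable n.
Proof.
elim: n => [//|n IH]; rewrite leq_eqVlt => /predU1P [<-|n2].
  by case: (depref_init HG t) => ->; rewrite !inE eqxx ?orbT.
have [i [hi ->]] := depref_step HG t n2.
by rewrite reachableS //; apply: allpairs_f; [exact: IH|rewrite mem_index_iota ltnS].
Qed.

Definition law n g : R := fine (P (G n @^-1` [set g])).

Definition mean n (phi : hgraph -> R) : R :=
  \sum_(g <- reachable n) law n g * phi g.

Lemma law_ge0 n g : 0 <= law n g.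
Proof. by rewrite fine_ge0. Qed.

Lemma lawE n g : (2 <= n)%N -> P (G n @^-1` [set g]) = (law n g)%:E.
Proof.
by move=> n2; rewrite /law fineK // fin_num_measure //; exact: (depref_measurable HG).
Qed.

(** As [attach] is injective, reaching [attach g i] means being at [g] and then choosing [i]. On the
    event G_n = [g] the conditional probability is constant, so its integral is a product. *)
Lemma law_attach n g i : (2 <= n)%N -> (1 <= i <= n)%N ->
  law n.+1 (attach g i) = law n g * attach_prob g n i.
Proof.
move=> n2 hi; have [_ /(_ (G n @^-1` [set g]))] := depref_law HG n2 hi.
have gF : natural_filtration G n (G n @^-1` [set g]).
  by apply: sub_sigma_algebra; exists n, [set g]; rewrite n2 leqnn.
move=> /(_ gF).
have -> : [set t | G n.+1 t = attach (G n t) i] `&` G n @^-1` [set g] =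
    G n.+1 @^-1` [set attach g i].
  apply/seteqP; split => t /=; first by case=> -> ->.
  have [j [_ ->]] := depref_step HG t n2.
  by move=> /attach_inj [-> ->].
rewrite (eq_integral (cst (attach_prob g n i)%:E)); last first.
  by move=> t; rewrite inE /= => ->.
rewrite integral_cst; last exact: (depref_measurable HG).
by rewrite (lawE _ (leqW n2)) [X in (_ * X)%E](lawE g n2) -EFinM => -[->]; rewrite mulrC.
Qed.

Lemma ler_mean n (phi psi : hgraph -> R) :
  (forall g, g \in reachable n -> phi g <= psi g) -> mean n phi <= mean n psi.
Proof.
move=> h; rewrite /mean big_seq_cond [leRHS]big_seq_cond; apply: ler_sum => g.
by rewrite andbT => /h; apply: ler_wpM2l; exact: law_ge0.
Qed.

(** Tower property: condition on G_n. *)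
Lemma meanS n phi : (2 <= n)%N ->
  mean n.+1 phi =
  mean n (fun g => \sum_(1 <= i < n.+1) attach_prob g n i * phi (attach g i)).
Proof.
move=> n2; rewrite /mean reachableS // big_allpairs_dep /=; apply: eq_bigr => g _.
rewrite mulr_sumr; apply: eq_big_nat => i; rewrite ltnS => hi.
by rewrite law_attach // mulrA.
Qed.

Lemma mean_affine n phi c :
  mean n (fun g => phi g + c) = mean n phi + c * mean n (fun=> 1).
Proof.
by rewrite /mean mulr_sumr -big_split; apply: eq_bigr => g _ /=; ring.
Qed.

(* In fact the mean of 1 is 1; the crude bound spares the disjointness of the
   two initial events. *)
Lemma mean1_le n : (2 <= n)%N -> mean n (fun=> 1) <= 2.
Proof.
elim: n => [//|n IH]; rewrite leq_eqVlt => /predU1P [<-|n2].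
  rewrite /mean /= !big_cons big_nil !mulr1 addr0 -[2]/(1 + 1).
  by apply: lerD; rewrite -lee_fin -lawE // probability_le1 //;
     exact: (depref_measurable HG).
rewrite meanS //; apply: le_trans (IH n2); apply: ler_mean => g gr.
under eq_bigr do rewrite mulr1.
by rewrite sum_attach_prob //; exact: reachable_well_formed.
Qed.

(** Each step adds at most 32 times the mean of 1, which is bounded by 2. *)
Lemma mean_energy_le K n : (2 <= n)%N -> mean n (energy R K n) <= 64 * n%:R.
Proof.
elim: n => [//|n IH]; rewrite leq_eqVlt => /predU1P [<-|n2].
  apply: (@le_trans _ _ (mean 2 (fun=> 0 + 8))).
    apply: ler_mean => g _; apply: le_trans (energy_le _ _ _ _) _; rewrite expr2; lra.
  rewrite mean_affine; have := @mean1_le 2 isT.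
  have -> : mean 2 (fun=> 0) = 0 by rewrite /mean big1 // => g _; rewrite mulr0.
  lra.
rewrite meanS //; apply: (@le_trans _ _ (mean n (fun g => energy R K n g + 32))).
  by apply: ler_mean => g gr; apply: energy_drift => //; exact: reachable_well_formed.
by rewrite mean_affine -natr1; have := mean1_le n2; have := IH n2; lra.
Qed.

Lemma markov_mean n (phi : hgraph -> R) (a : R) : (2 <= n)%N -> 0 < a ->
  (forall g, 0 <= phi g) ->
  (P (G n @^-1` [set g | (a < phi g)%R]) <= (mean n phi / a)%:E)%E.
Proof.
move=> n2 a0 phi0.
have meas (B : set hgraph) : measurable (G n @^-1` B) by exact: (depref_measurable HG).
(* Union bound over a list: a graph with [a < phi g] has mass at most [law n g * phi g / a]. *)
have cover (s : seq hgraph) :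
    (P (G n @^-1` [set g | g \in s /\ (a < phi g)%R]) <=
     (\sum_(g <- s) law n g * phi g / a)%:E)%E.
  elim: s => [|g s IH].
    rewrite big_nil (_ : _ @^-1` _ = set0) ?measure0 //.
    by apply/seteqP; split=> t //= [].
  rewrite big_cons EFinD.
  apply: (@le_trans _ _ (P (G n @^-1` [set h | h = g /\ a < phi g] `|`
     G n @^-1` [set h | h \in s /\ a < phi h]))).
    apply: le_measure; rewrite ?inE //; first exact: measurableU.
    by move=> t /= []; rewrite inE => /orP [/eqP ->|]; [left|right].
  apply: (le_trans (measureU2 _ _ _)) => //; apply: leeD => //.
  have [ag|ag] := ltP a (phi g).
    apply: (@le_trans _ _ (P (G n @^-1` [set g]))).
      by apply: le_measure; rewrite ?inE // => t /= [].
    rewrite lawE // lee_fin -mulrA ler_peMr ?law_ge0 //.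
    by rewrite ler_pdivlMr // mul1r ltW.
  rewrite (_ : _ @^-1` _ = set0) ?measure0; last by apply/seteqP; split=> t //= [].
  by rewrite lee_fin divr_ge0 ?mulr_ge0 ?law_ge0 // ltW.
apply: le_trans (le_trans (cover (reachable n)) _).
  apply: le_measure; rewrite ?inE // => t /= h; split=> //.
  exact: process_reachable.
by rewrite /mean mulr_suml.
Qed.

End Expectation.

(** * From the energy bound to the maximal deviation *)

Lemma degree_fraction_sub_limit (R : realType) n g k : (0 < n)%N -> (0 < k)%N ->
  degree_fraction g n k - limit_fraction k = n%:R^-1 * excess R g n k :> R.
Proof.
move=> n0; case: k => [//|k] _; rewrite /excess /degree_fraction -/(degree_count R g n k.+1) /limit_mass.
by field; rewrite pnatr_eq0 -lt0n.
Qed.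

Lemma max_deviation_le (R : realType) n g : (2 <= n)%N -> well_formed n g ->
  2 <= ln n%:R :> R -> energy R n n g <= n%:R * ln n%:R ->
  max_deviation g n <= ln n%:R / n%:R + Num.sqrt (ln n%:R / n%:R) :> R.
Proof.
move=> n2 gw ln1 hE; have hn : (2:R) <= n%:R by rewrite ler_nat.
have n0 : 0 < n%:R :> R by lra.
apply: ge_sup; first by exists `|degree_fraction g n 1 - limit_fraction 1|; exists 1%N.
move=> _ [k /= k1 <-]; rewrite degree_fraction_sub_limit //; last by lia.
rewrite normrM ger0_norm ?invr_ge0 //.
have [kn|nk] := leqP k n.
  rewrite -[leLHS]add0r; apply: lerD; first by rewrite divr_ge0; lra.
  (* For k <= n, x_k^2 is one term of the energy, so (x_k / n)^2 <= ln n / n: the square-root term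
     suffices. *)
  rewrite -[_ * _]ger0_norm ?mulr_ge0 ?invr_ge0 // -sqrtr_sqr ler_wsqrtr //.
  rewrite exprMn real_normK ?num_real //.
  have hx : excess R g n k ^+ 2 <= n%:R * ln n%:R.
    apply: le_trans hE; rewrite /energy; have hk : (k.-1 < n)%N by lia.
    rewrite (bigD1 (Ordinal hk)) //= prednK // lerDl.
    by apply: sumr_ge0 => j _; exact: sqr_ge0.
  apply: (@le_trans _ _ (n%:R^-1 ^+ 2 * (n%:R * ln n%:R))).
    by rewrite ler_wpM2l // sqr_ge0.
  by rewrite le_eqVlt; apply/orP; left; apply/eqP; field; lra.
(* For k > n, k N_k <= 2n - 1 gives N_k < 2, and n p_k <= k p_k <= 1; so |x_k| <= 2 <= ln n and the
   logarithmic term suffices. *)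
rewrite -[leLHS]addr0; apply: lerD; last exact: sqrtr_ge0.
rewrite mulrC ler_pM2r ?invr_gt0 //; apply: le_trans ln1.
have hk : n%:R + 1 <= k%:R :> R by rewrite natr1 ler_nat.
have sum_le := mul_degree_count_le R k gw; have c0 := degree_count_ge0 R g n k.
have pk := mul_limit_mass_le1 R k.
have p0 := limit_mass_ge0 R k.
rewrite /excess ler_norml; apply/andP; split; nra.
Qed.

Theorem theorem2p3 (R : realType) (d : measure_display) (T : measurableType d)
    (P : probability T R) (G : nat -> T -> hgraph)
    (HG : depreferential_attachment P G) :
  exists C1 : R, 0 < C1 /\
    (fun n : nat =>
       P [set t | C1 * (ln n%:R / n%:R + Num.sqrt (ln n%:R / n%:R))
                  < max_deviation (G n t) n]) @ \oo --> 0%E.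
Proof.
exists 1; split=> //.
have ln_large (a : R) : \forall n \near \oo, a <= ln n%:R :> R.
  near=> n; have hn : expR a <= n%:R by near: n; exact: cvgry_ge (@cvgr_idn R) _.
  by rewrite -[a]expRK ler_ln ?posrE ?expR_gt0 // (lt_le_trans (expR_gt0 a) hn).
(* Markov's inequality at level n ln n, with mean energy at most 64 n, gives 64 / ln n. *)
apply: (@squeeze_cvge _ _ _ _ (cst 0%E) _ (fun n => (64 / ln n%:R : R)%:E)).
- near=> n; rewrite measure_ge0 /=.
  have n2 : (2 <= n)%N by near: n; exact: nbhs_infty_ge.
  have n0 : 0 < n%:R :> R by rewrite ltr0n; lia.
  have lnn : 2 <= ln n%:R :> R by near: n; exact: ln_large.
  have nln0 : 0 < n%:R * ln n%:R :> R by rewrite mulr_gt0 //; lra.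
  have meas (B : set hgraph) : measurable (G n @^-1` B) by exact: (depref_measurable HG).
  (* The cutoff [K = n] may grow with n because the mean energy bound is uniform in [K]. *)
  apply: (@le_trans _ _ (P (G n @^-1` [set g | n%:R * ln n%:R < energy R n n g]))).
    apply: le_measure; rewrite ?inE //.
      exact: (meas [set g | 1 * (ln n%:R / n%:R + Num.sqrt (ln n%:R / n%:R)) < max_deviation g n]).
    move=> t /=; rewrite mul1r; apply: contraTT; rewrite -!leNgt => hE.
    apply: max_deviation_le => //.
    by apply: (@reachable_well_formed n) => //; exact: process_reachable HG _ _ n2.
  apply: le_trans (markov_mean HG n2 nln0 (energy_ge0 R n n)) _.
  rewrite lee_fin ler_pdivrMr // (_ : 64 / _ * _ = 64 * n%:R); first exact: mean_energy_le.
  by field; lra.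
- exact: cvg_cst.
- apply/fine_cvgP; split; first by near=> n.
  apply/cvgrPdist_le => e e0; near=> n; rewrite /= sub0r normrN.
  have h : 64 / e <= ln n%:R by near: n; exact: ln_large.
  have ln0 : 0 < ln n%:R :> R by apply: lt_le_trans h; rewrite divr_gt0.
  rewrite ger0_norm ?divr_ge0 ?(ltW ln0) ?(ltW e0) //.
  by rewrite ler_pdivrMr // mulrC -ler_pdivrMr.
Unshelve. all: by end_near.
Qed.
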